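(* Let $m$ be an even positive integer. Then there does not exist a set of $2$-maxMOFS$(2m;m)$. Equivalently: for any two orthogonal frequency squares $F_1,F_2$ of type $(2m;m)$, there exists a frequency square $F$ of type $(2m;m)$ that is orthogonal to both $F_1$ and $F_2$.
   Context: A frequency square of type $(n;\lambda)$ (with $\lambda\mid n$) is an $n\times n$ array on the symbol set $\{0,1,\dots,n/\lambda-1\}$ in which each symbol occurs exactly $\lambda$ times in each row and exactly $\lambda$ times in each column. Two frequency squares of type $(n;\lambda)$ are orthogonal if, when superimposed, each ordered pair of symbols $(i,j)$ occurs exactly $\lambda^2$ times. A set of $k$-MOFS$(n;\lambda)$ is a set of $k$ pairwise orthogonal frequency squares of type $(n;\lambda)$; it is maximal (written $k$-maxMOFS$(n;\lambda)$) if there is no frequency square of type $(n;\lambda)$ orthogonal to every square in the set. *)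

(* Defs.v *)
From mathcomp Require Import all_boot all_algebra.
Set Implicit Arguments.
Unset Strict Implicit.
Unset Printing Implicit Defensive.

Notation symbol n l := 'I_(n %/ l).

Notation array n l := 'M[symbol n l]_n.

(* The side condition l %| n is not repeated: counting the n cells of a row
   gives n = (n %/ l) * l. *)
Definition is_freq_square (n l : nat) (F : array n l) : bool :=
  [forall s : symbol n l,
    [forall i, #|[set j | F i j == s]| == l] &&
    [forall j, #|[set i | F i j == s]| == l]].

Definition orth_squares (n l : nat) (F G : array n l) : bool :=
  [forall s : symbol n l, forall t : symbol n l,
    #|[set c : 'I_n * 'I_n | (F c.1 c.2 == s) && (G c.1 c.2 == t)]| == l ^ 2].

Definition is_MOFS (k n l : nat) (S : {set array n l}) : bool :=
  [&& #|S| == k,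
      [forall F in S, is_freq_square F] &
      [forall F in S, forall G in S, (F != G) ==> orth_squares F G]].

Definition is_maxMOFS (k n l : nat) (S : {set array n l}) : bool :=
  is_MOFS k S &&
  ~~ [exists F : array n l,
       is_freq_square F && [forall G in S, orth_squares F G]].

(* Main.v *)
Require Import Defs.
From mathcomp Require Import all_boot all_algebra.

(** Regard the cell (i, j) as an edge joining the vertices (i, F1 i j) and
    (j, F2 i j) of a bipartite graph.  Every vertex has degree m, which is even,
    so colouring the edges alternately along closed Eulerian trails (which have
    even length) splits the edges at every vertex into two halves.  Balance at
    the vertices (i, s) makes the rows of the colouring balanced and orthogonal
    to F1; balance at the vertices (j, t) does the same for columns and F2. *)

(** The matchings [x -- s x] and [x -- t x] together form closed cycles alternating between the two.
    Each cycle consists of two orbits of [s \o t], exchanged by both [s] and [t]; these are the two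
    colour classes. *)
Lemma alternating_coloring (T : finType) (s t : T -> T) :
  involutive s -> involutive t ->
  (forall x, s x != x) -> (forall x, t x != x) ->
  exists g : T -> bool, forall x, g (s x) = ~~ g x /\ g (t x) = ~~ g x.
Proof.
move=> sK tK sN tN; pose f := s \o t.
have f_inj : injective f.
  by apply: inj_comp; [apply: inv_inj sK | apply: inv_inj tK].
(* In the dihedral group generated by [s] and [t] every reflection is conjugate
   to [s] or [t], so it has no fixed point. *)
have iterN k x : iter k f x != s x.
  elim/ltn_ind: k x => -[|[|k]] IH x; first by rewrite eq_sym.
    by apply/eqP => /(inv_inj sK)/eqP; apply/negP.
  apply/eqP; rewrite iterS iterSr => /(inv_inj sK) /(congr1 t).
  rewrite tK => e; have/eqP[] := IH k (ltnW (ltnSn _)) (f x).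
  by rewrite e /f /= sK.
have sym : connect_sym (frel f) by apply: fconnect_sym.
have rootN x : froot f x != froot f (s x).
  rewrite (root_connect sym); apply/negP => /iter_findex.
  by apply/eqP/iterN.
have root_f x : froot f (f x) = froot f x.
  by apply/eqP; rewrite (root_connect sym) sym fconnect1.
(* Comparing ranks of orbit representatives chooses one orbit from each pair exchanged by [s]. *)
pose g x := enum_rank (froot f x) < enum_rank (froot f (s x)).
have gs x : g (s x) = ~~ g x.
  rewrite /g sK -leqNgt ltn_neqAle (inj_eq (@ord_inj _)).
  by rewrite (inj_eq enum_rank_inj) eq_sym rootN.
exists g => x; split=> //.
have -> : t x = s (f x) by rewrite /f /= sK.
rewrite gs; congr (~~ _); rewrite /g root_f; congr (_ < enum_rank _).
(* Here [f (s (f x)) = s x], because conjugation by [s] inverts [f]. *)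
by rewrite -(root_f (s (f x))) /f /= sK tK.
Qed.

(** With [p] sending an edge to its endpoint on one side, [s] pairs the edges at each vertex: a
    trail entering by one leaves by the other. *)
Lemma fiber_involution (T : finType) (A : eqType) (p : T -> A) :
  (forall v, ~~ odd #|[set x | p x == v]|) ->
  exists s : T -> T,
    [/\ involutive s, forall x, s x != x & forall x, p (s x) = p x].
Proof.
move=> even_p.
pose e v := enum [set x | p x == v].
have e_in x v : (x \in e v) = (p x == v) by rewrite mem_enum inE.
(* Exchanges the positions [2k] and [2k + 1] in the enumeration of a fibre. *)
pose flip i := if odd i then i.-1 else i.+1.
have flipK : involutive flip.
  by rewrite /flip => -[|i] //=; case oi: (odd i) => //=; rewrite oi.
have flipN i : flip i != i.
  rewrite /flip; case: i => [|i] //=; case: odd => /=; last by rewrite neq_ltn leqnn.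
  by rewrite neq_ltn ltnSn orbT.
have flip_lt i v : i < size (e v) -> flip i < size (e v).
  have: ~~ odd (size (e v)) by rewrite -cardE even_p.
  rewrite /flip; case oi: (odd i) => ev lt_i.
    by apply: leq_ltn_trans (leq_pred _) lt_i.
  (* For even [i], the successor cannot equal the size of the fibre, which is even. *)
  by rewrite ltn_neqAle lt_i andbT; apply: contraNneq ev => <-; rewrite /= oi.
pose s x := nth x (e (p x)) (flip (index x (e (p x)))).
have idx_lt x : index x (e (p x)) < size (e (p x)) by rewrite index_mem e_in.
have ps x : p (s x) = p x.
  by apply/eqP; rewrite -e_in mem_nth // flip_lt.
exists s; split=> // x.
  rewrite {1}/s ps index_uniq ?enum_uniq ?flip_lt // flipK.
  by rewrite (set_nth_default x) ?nth_index ?e_in.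
apply/eqP => sx; have/eqP[] := flipN (index x (e (p x))).
by rewrite -[RHS](congr1 (index^~ (e (p x))) sx) index_uniq ?enum_uniq ?flip_lt.
Qed.

(** [s] maps each colour class of [P] bijectively onto the other. *)
Lemma swap_half (T : finType) (s : T -> T) (P g : pred T) (b : bool) :
  involutive s -> (forall x, P (s x) = P x) -> (forall x, g (s x) = ~~ g x) ->
  #|[set x | P x && (g x == b)]| = #|[set x | P x]|./2.
Proof.
move=> sK sP sg.
have swap : #|[set x | P x && (g x == ~~ b)]| = #|[set x | P x && (g x == b)]|.
  rewrite -(card_imset _ (inv_inj sK)); apply: eq_card => x.
  rewrite (can_imset_pre _ sK) !inE sP sg.
  by case: (g x) b => -[].
rewrite -(cardsID [set x | g x == b] [set x | P x]) -setIdE.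
have -> : [set x | P x] :\: [set x | g x == b] = [set x | P x && (g x == ~~ b)].
  by apply/setP=> x; rewrite !inE andbC; case: (g x); case: (b).
have -> : [set x in [set x | P x] | g x == b] = [set x | P x && (g x == b)].
  by apply/setP=> x; rewrite !inE.
by rewrite swap addnn doubleK.
Qed.

Lemma bipartite_halving (T : finType) (A B : eqType) (p : T -> A) (q : T -> B) :
  (forall v, ~~ odd #|[set x | p x == v]|) ->
  (forall v, ~~ odd #|[set x | q x == v]|) ->
  exists g : T -> bool,
    (forall v b, #|[set x | (p x == v) && (g x == b)]|
                   = #|[set x | p x == v]|./2) /\
    (forall v b, #|[set x | (q x == v) && (g x == b)]|
                   = #|[set x | q x == v]|./2).
Proof.
move=> /fiber_involution[s [sK sN ps]] /fiber_involution[t [tK tN qt]].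
have [g gP] := @alternating_coloring _ s t sK tK sN tN.
exists g; split=> v b.
  by apply: (@swap_half _ s) => // x; rewrite ?ps //; case: (gP x).
by apply: (@swap_half _ t) => // x; rewrite ?qt //; case: (gP x).
Qed.

Lemma card_fiberwise (T A : finType) (p : T -> A) (P : pred T) (k : nat) :
  (forall v, #|[set x | (p x == v) && P x]| = k) -> #|[set x | P x]| = #|A| * k.
Proof.
move=> pk; rewrite -sum1dep_card (partition_big p xpredT) //=.
rewrite -sum_nat_const; apply: eq_bigr => v _; rewrite -[RHS](pk v) -sum1dep_card.
by apply: eq_bigl => x; rewrite andbC.
Qed.

(** For rows [p] and symbols [q], summing the balance at the vertices over symbols gives the row
    counts of the new square, and summing over rows gives its orthogonality counts. Columns are
    treated likewise. *)
Lemma card_fiber_pair (T A B : finType) (p : T -> A) (q : T -> B) (P : pred T)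
    (k : nat) :
  (forall v, #|[set x | ((p x, q x) == v) && P x]| = k) ->
  (forall a, #|[set x | (p x == a) && P x]| = #|B| * k) /\
  (forall b, #|[set x | (q x == b) && P x]| = #|A| * k).
Proof.
move=> pqk; split=> [a|b].
  apply: (@card_fiberwise _ _ q) => b; rewrite -[RHS](pqk (a, b)).
  by apply: eq_card => x; rewrite !inE xpair_eqE andbA [(q x == b) && _]andbC.
apply: (@card_fiberwise _ _ p) => a; rewrite -[RHS](pqk (a, b)).
by apply: eq_card => x; rewrite !inE xpair_eqE andbA.
Qed.

Lemma card_row_cells (I J : finType) (i : I) (P : I * J -> bool) :
  #|[set c | (c.1 == i) && P c]| = #|[set j | P (i, j)]|.
Proof.
rewrite -[RHS](@card_imset _ _ (pair i)) => [|j j' []//].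
apply: eq_card => -[i' j]; rewrite !inE /=.
apply/andP/imsetP => [[/eqP-> Pj]|[j']]; first by exists j; rewrite ?inE.
by rewrite inE => Pj [-> ->].
Qed.

Lemma card_col_cells (I J : finType) (j : J) (P : I * J -> bool) :
  #|[set c | (c.2 == j) && P c]| = #|[set i | P (i, j)]|.
Proof.
rewrite -[RHS](@card_imset _ _ (pair^~ j)) => [|i i' []//].
apply: eq_card => -[i j']; rewrite !inE /=.
apply/andP/imsetP => [[/eqP-> Pi]|[i']]; first by exists i; rewrite ?inE.
by rewrite inE => Pi [-> ->].
Qed.

Lemma orthogonal_mate (m : nat) (F1 F2 : array (2 * m) m) :
  0 < m -> ~~ odd m -> is_freq_square F1 -> is_freq_square F2 ->
  exists F : array (2 * m) m,
    [/\ is_freq_square F, orth_squares F F1 & orth_squares F F2].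
Proof.
move=> m_gt0 m_even sq1 sq2.
have m2 : (2 * m./2 = m)%N by rewrite mul2n even_halfK.
have cardS : #|symbol (2 * m) m| = 2 by rewrite card_ord mulnK.
pose p (c : 'I_(2 * m) * 'I_(2 * m)) := (c.1, F1 c.1 c.2).
pose q (c : 'I_(2 * m) * 'I_(2 * m)) := (c.2, F2 c.1 c.2).
have card_p (v : 'I_(2 * m) * symbol (2 * m) m) : #|[set c | p c == v]| = m.
  case: v => i t; have /forallP/(_ t)/andP[/forallP/(_ i)/eqP + _] := sq1.
  by rewrite -(card_row_cells _ _ i (fun c => F1 c.1 c.2 == t)).
have card_q (v : 'I_(2 * m) * symbol (2 * m) m) : #|[set c | q c == v]| = m.
  case: v => j t; have /forallP/(_ t)/andP[_ /forallP/(_ j)/eqP] := sq2.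
  by rewrite -(card_col_cells _ _ j (fun c => F2 c.1 c.2 == t)).
have [||g [gp gq]] := @bipartite_halving _ _ _ p q.
- by move=> v; rewrite card_p.
- by move=> v; rewrite card_q.
(* The symbol type has two elements by [cardS], but not by computation, so colours become symbols
   through a bijection. *)
have [sy [sy' syK sy'K]] : exists sy : bool -> symbol (2 * m) m, bijective sy.
  have E : #|{: bool}| = #|symbol (2 * m) m| by rewrite cardS card_bool.
  exists (enum_val \o cast_ord E \o enum_rank); apply: inj_card_bij.
    by move=> b c /= /enum_val_inj/cast_ord_inj/enum_rank_inj.
  by rewrite E.
pose F : array (2 * m) m := (\matrix_(i, j) sy (g (i, j)))%R.
have FE i j s : (F i j == s) = (g (i, j) == sy' s).
  by rewrite mxE -(can2_eq syK sy'K).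
have half_p b : forall v, #|[set c | (p c == v) && (g c == b)]| = m./2.
  by move=> v; rewrite gp card_p.
have half_q b : forall v, #|[set c | (q c == v) && (g c == b)]| = m./2.
  by move=> v; rewrite gq card_q.
(* Each of the [2 * m] rows or columns contributes [m./2] cells to a given pair of symbols. *)
have sqm : (#|'I_(2 * m)| * m./2 = m ^ 2)%N by rewrite card_ord mulnAC m2.
exists F; split.
- apply/forallP => s; apply/andP; split; apply/forallP => i; apply/eqP.
    rewrite (eq_card (B := [set j | g (i, j) == sy' s])) => [|j]; last first.
      by rewrite !inE FE.
    rewrite -(card_row_cells _ _ i (fun c => g c == sy' s)).
    by rewrite (card_fiber_pair _ _ _ _ _ _ _ (half_p _)).1 cardS.
  rewrite (eq_card (B := [set j | g (j, i) == sy' s])) => [|j]; last first.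
    by rewrite !inE FE.
  rewrite -(card_col_cells _ _ i (fun c => g c == sy' s)).
  by rewrite (card_fiber_pair _ _ _ _ _ _ _ (half_q _)).1 cardS.
- apply/forallP => s; apply/forallP => t; apply/eqP.
  rewrite -sqm -((card_fiber_pair _ _ _ _ _ _ _ (half_p (sy' s))).2 t).
  by apply: eq_card => -[i j]; rewrite !inE FE andbC.
- apply/forallP => s; apply/forallP => t; apply/eqP.
  rewrite -sqm -((card_fiber_pair _ _ _ _ _ _ _ (half_q (sy' s))).2 t).
  by apply: eq_card => -[i j]; rewrite !inE FE andbC.
Qed.

Theorem theorem5p1 (m : nat) (m_gt0 : 0 < m) (m_even : ~~ odd m) :
  (~ exists S : {set array (2 * m) m}, is_maxMOFS 2 S) /\
  (forall F1 F2 : array (2 * m) m,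
     is_freq_square F1 -> is_freq_square F2 -> orth_squares F1 F2 ->
     exists F : array (2 * m) m,
       [/\ is_freq_square F, orth_squares F F1 & orth_squares F F2]).
Proof.
(* A set of two squares is [[set F1; F2]], and a common mate of both contradicts maximality. *)
split=> [[S /andP[/and3P[/cards2P[F1 [F2 [_ ->]]] /forall_inP sq _]]]|F1 F2 sq1 sq2 _].
  have [||F [sqF F_F1 F_F2]] := @orthogonal_mate m F1 F2 m_gt0 m_even.
  - by apply: sq; rewrite !inE eqxx.
  - by apply: sq; rewrite !inE eqxx orbT.
  move/negP; apply; apply/existsP; exists F; rewrite sqF /=.
  by apply/forall_inP => G; rewrite !inE => /orP[] /eqP->.
exact: orthogonal_mate.
Qed.
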